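(* Let $a>0$ and $\lambda>0$ be real numbers, and let $(p_k)_{k\ge 0}$ be the sequence of real numbers defined by the recurrence $$p_0=a,\qquad p_1=\lambda a,\qquad p_k=\sqrt{p_{k-1}^2+p_{k-2}^2}\quad\text{for all } k=2,3,4,\ldots$$ Then $$\lim_{k\to\infty}\frac{p_{k+1}}{p_k}=\sqrt{\phi},$$ where $\phi$ is the golden ratio.
   Context: The golden ratio is $\phi=\frac{1+\sqrt5}{2}=1.618033989\ldots$. *)

(* Defs.v *)
From Stdlib Require Import Reals.
Open Scope R_scope.

Definition golden_ratio : R := (1 + sqrt 5) / 2.

(* Main.v *)
Require Import Defs.
From Stdlib Require Import Reals Lra Lia.
From Coquelicot Require Import Coquelicot.
Open Scope R_scope.

(** The squares [q k = p k ^ 2] satisfy the linear Fibonacci recurrence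
    [q (k+2) = q (k+1) + q k], with characteristic roots [golden_ratio] and
    [1 - golden_ratio].  The combination [q (k+1) - golden_ratio * q k] kills the
    dominant root, so it is exactly geometric of ratio [1 - golden_ratio]
    ([fibonacci_defect]), which has modulus less than [1].  As a positive Fibonacci
    sequence stays away from [0] ([fibonacci_lower_bound]), dividing by [q k] shows
    that [q (k+1) / q k] tends to [golden_ratio] ([fibonacci_ratio_lim]).
    Since [p] is positive, [p (k+1) / p k] is the square root of that quotient, and
    continuity of [sqrt] concludes. *)

Lemma golden_ratio_sqr : golden_ratio ^ 2 = golden_ratio + 1.
Proof.
  assert (H := sqrt_sqrt 5 ltac:(lra)).
  unfold golden_ratio; nra.
Qed.

Lemma golden_ratio_bounds : 1 < golden_ratio < 2.
Proof.
  assert (H := sqrt_sqrt 5 ltac:(lra)).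
  assert (H0 := sqrt_pos 5).
  unfold golden_ratio; split; nra.
Qed.

Lemma fibonacci_defect (q : nat -> R)
  (hq : forall k, q (S (S k)) = q (S k) + q k) (k : nat) :
  q (S k) - golden_ratio * q k =
  (1 - golden_ratio) ^ k * (q 1%nat - golden_ratio * q 0%nat).
Proof.
  induction k as [|k IH]; [simpl; ring|].
  rewrite <- tech_pow_Rmult, Rmult_assoc, <- IH, hq.
  assert (H := golden_ratio_sqr).
  (* The two sides differ by q k times the characteristic equation. *)
  transitivity (q (S k) + q k - golden_ratio * q (S k)
                + q k * (golden_ratio ^ 2 - (golden_ratio + 1))).
  - rewrite H; ring.
  - ring.
Qed.

Lemma fibonacci_lower_bound (q : nat -> R) (m : R) (hm : 0 <= m)
  (h0 : m <= q 0%nat) (h1 : m <= q 1%nat)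
  (hq : forall k, q (S (S k)) = q (S k) + q k) (k : nat) : m <= q k.
Proof.
  assert (H : m <= q k /\ m <= q (S k)).
  { induction k as [|k [IH1 IH2]]; [now split|].
    split; [exact IH2|rewrite hq; lra]. }
  apply H.
Qed.

Lemma fibonacci_ratio_lim (q : nat -> R) (h0 : 0 < q 0%nat) (h1 : 0 < q 1%nat)
  (hq : forall k, q (S (S k)) = q (S k) + q k) :
  is_lim_seq (fun k => q (S k) / q k) golden_ratio.
Proof.
  pose (m := Rmin (q 0%nat) (q 1%nat)).
  assert (hm : 0 < m) by (apply Rmin_pos; assumption).
  assert (hqm : forall k, m <= q k).
  { apply fibonacci_lower_bound; [lra|apply Rmin_l|apply Rmin_r|exact hq]. }
  pose (D := q 1%nat - golden_ratio * q 0%nat).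
  assert (hg := golden_ratio_bounds).
  assert (herr : is_lim_seq
            (fun k => (1 - golden_ratio) ^ k * D / q k) 0).
  { apply is_lim_seq_abs_0.
    apply is_lim_seq_le_le with (u := fun _ => 0)
      (w := fun k => Rabs (1 - golden_ratio) ^ k * (Rabs D / m)).
    - intro k; split; [apply Rabs_pos|].
      specialize (hqm k).
      unfold Rdiv.
      rewrite !Rabs_mult, <- RPow_abs, Rmult_assoc.
      apply Rmult_le_compat_l; [apply pow_le, Rabs_pos|].
      apply Rmult_le_compat_l; [apply Rabs_pos|].
      rewrite Rabs_inv, (Rabs_pos_eq (q k)) by lra.
      apply Rinv_le_contravar; assumption.
    - apply is_lim_seq_const.
    - replace (Finite 0) with (Rbar_mult 0 (Rabs D / m))
        by (simpl; f_equal; ring).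
      apply is_lim_seq_scal_r, is_lim_seq_geom.
      rewrite Rabs_Rabsolu; apply Rabs_def1; lra. }
  apply is_lim_seq_ext with
    (fun k => golden_ratio + (1 - golden_ratio) ^ k * D / q k).
  - intro k; specialize (hqm k); unfold D.
    rewrite <- (fibonacci_defect q hq); field; lra.
  - replace (Finite golden_ratio) with (Finite (golden_ratio + 0))
      by (f_equal; ring).
    apply is_lim_seq_plus'; [apply is_lim_seq_const|exact herr].
Qed.

Theorem mainTheorem1 (a lambda : R) (p : nat -> R)
  (ha : 0 < a) (hlambda : 0 < lambda)
  (hp0 : p 0%nat = a) (hp1 : p 1%nat = lambda * a)
  (hp : forall k : nat, (2 <= k)%nat ->
          p k = sqrt (p (k - 1)%nat ^ 2 + p (k - 2)%nat ^ 2)) :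
  is_lim_seq (fun k : nat => p (k + 1)%nat / p k) (Finite (sqrt golden_ratio)).
Proof.
  assert (hrec : forall k, p (S (S k)) = sqrt (p (S k) ^ 2 + p k ^ 2)).
  { intro k; rewrite (hp (S (S k))) by lia.
    now replace (S (S k) - 1)%nat with (S k) by lia;
        replace (S (S k) - 2)%nat with k by lia. }
  assert (hpos : forall k, 0 < p k).
  { intro k.
    assert (H : 0 < p k /\ 0 < p (S k)); [|apply H].
    induction k as [|k [IH1 IH2]].
    - rewrite hp0, hp1; split; [assumption|now apply Rmult_lt_0_compat].
    - split; [exact IH2|].
      rewrite hrec; apply sqrt_lt_R0; nra. }
  apply is_lim_seq_ext with (fun k => sqrt (p (S k) ^ 2 / p k ^ 2)).
  - intro k; rewrite Nat.add_1_r.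
    assert (H1 := hpos k); assert (H2 := hpos (S k)).
    rewrite sqrt_div_alt by nra.
    now rewrite !sqrt_pow2 by lra.
  - apply is_lim_seq_continuous.
    + apply continuity_pt_sqrt; assert (H := golden_ratio_bounds); lra.
    + apply (fibonacci_ratio_lim (fun k => p k ^ 2)).
      * apply pow_lt, hpos.
      * apply pow_lt, hpos.
      * intro k; rewrite hrec; apply pow2_sqrt.
        assert (H := pow2_ge_0 (p k)); assert (H' := pow2_ge_0 (p (S k))); lra.
Qed.
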